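(* For all $w,v\in W$, $$\tilde p(w,v)=(-1)^{\ell(v)-\ell(w)}\,p(vw_0,\,ww_0).$$
   Context: Let $(\Lambda,\Lambda^*,R,R^* )$ be a reduced semisimple root datum: $\Lambda\simeq\mathbb Z^r$ is a weight lattice with pairing $\langle\,,\rangle:\Lambda^*\times\Lambda\to\mathbb Z$, $R\subset\Lambda$ is a root system with simple roots $\alpha_1,\dots,\alpha_r$ and positive roots $R^+$, and $R^*\subset\Lambda^*$ is the set of coroots $\alpha^*$. $W$ is the Weyl group generated by the simple reflections $S=\{s_1,\dots,s_r\}$, $s_i(\lambda)=\lambda-\langle\alpha_i^*,\lambda\rangle\alpha_i$; $\ell$ is the length function, $\le$ the Bruhat order, $e$ the identity, $w_0$ the longest element, $m_{i,j}$ the order of $s_is_j$. Let $t_1,t_2$ be indeterminates, $Q(\mathbb Z[\Lambda])$ the quotient field of the group algebra $\mathbb Z[\Lambda]$ (with basis $e^\lambda$, $\lambda\in\Lambda$), and $Q_{t_1,t_2}(\Lambda)=\mathbb Z[t_1,t_2]\otimes Q(\mathbb Z[\Lambda])$. $W$ acts on $Q_{t_1,t_2}(\Lambda)$ by $w(e^\lambda)=e^{w\lambda}$, fixing $t_1,t_2$. The generic Hecke algebra $H=H^{Q(\Lambda)}_{t_1,t_2}(W)$ is the $Q_{t_1,t_2}(\Lambda)$-algebra (with central coefficients) with generators $h_1,\dots,h_r$ ($h_i=h_{s_i}$) and relations $(h_i-t_1)(h_i-t_2)=0$ and the braid relations $h_ih_j\cdots=h_jh_i\cdots$ ($m_{i,j}$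 factors). For a reduced expression $w=s_{i_1}\cdots s_{i_\ell}$ put $h_w=h_{i_1}\cdots h_{i_\ell}$; $\{h_w\}_{w\in W}$ is a $Q_{t_1,t_2}(\Lambda)$-basis of $H$. For $\lambda\in\Lambda$ let $E(\lambda)=e^{-\lambda}-1$. The Yang-Baxter basis $\{Y_w\}_{w\in W}$ of $H$ is defined recursively by $Y_e=1$ and $Y_w=Y_{w'}\left(h_i+\frac{t_1+t_2}{w'E(\alpha_i)}\right)$ if $w=w's_i>w'$ (this is independent of choices; $w'E(\alpha_i)=E(w'\alpha_i)$). The transition coefficients $p(w,v),\tilde p(w,v)\in Q_{t_1,t_2}(\Lambda)$ are defined by $Y_v=\sum_{w\le v}p(w,v)h_w$ and $h_v=\sum_{w\le v}\tilde p(w,v)Y_w$, and are $0$ when $w\not\le v$. *)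

(* Defs.v *)
From HB Require Import structures.
From mathcomp Require Import all_boot all_order all_algebra all_fingroup.
From mathcomp Require Import boolp.
From mathcomp Require Export mpoly.

Set Implicit Arguments.
Unset Strict Implicit.
Unset Printing Implicit Defensive.

Import GRing.Theory.
Local Open Scope ring_scope.

(* The lattice is 'cV[int]_r, its dual is 'rV[int]_r, and the perfect pairing *)
(* between them is the matrix product.                                        *)

Definition pairing (r : nat) (f : 'rV[int]_r) (x : 'cV[int]_r) : int :=
  (f *m x) ord0 ord0.

(* A reduced semisimple root datum together with a choice of simple roots.    *)
(* [coroot] is only meaningful on members of [root]; the coroots R^* are its  *)
(* values there.                                                              *)
Record rootDatum (r : nat) := RootDatum {
  root : seq 'cV[int]_r;
  coroot : 'cV[int]_r -> 'rV[int]_r;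
  simple : 'I_r -> 'cV[int]_r;
  coroot_inj : {in root &, injective coroot};
  pairing_coroot : forall a, a \in root -> pairing (coroot a) a = 2;
  root_stable : forall a b, a \in root -> b \in root ->
    b - pairing (coroot a) b *: a \in root;
  coroot_stable : forall a b, a \in root -> b \in root ->
    coroot b - pairing (coroot b) a *: coroot a \in [seq coroot c | c <- root];
  root_reduced : forall a, a \in root -> a *+ 2 \notin root;
  root_semisimple : forall x : 'cV[int]_r,
    exists (n : int) (c : 'cV[int]_r -> int),
      n != 0 /\ n *: x = \sum_(a <- root) c a *: a;
  simple_root : forall i, simple i \in root;
  simple_free : forall c : 'I_r -> int,
    \sum_i c i *: simple i = 0 -> forall i, c i = 0;
  simple_base : forall a, a \in root -> exists c : 'I_r -> nat,
    a = \sum_i simple i *+ c i \/ a = - \sum_i simple i *+ c i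
}.

Section WeylGroup.
Variables (r : nat) (D : rootDatum r).

Definition refl_mx (a : 'cV[int]_r) : 'M[int]_r := 1%:M - a *m coroot D a.

Lemma refl_mxE a (x : 'cV[int]_r) :
  refl_mx a *m x = x - pairing (coroot D a) x *: a.
Proof.
rewrite mulmxBl mul1mx -mulmxA; congr (_ - _).
by rewrite [coroot D a *m x]mx11_scalar mul_mx_scalar.
Qed.

Definition word_mx (s : seq 'I_r) : 'M[int]_r :=
  foldr (fun i A => refl_mx (simple D i) *m A) 1%:M s.

Definition weyl_pred : {pred 'M[int]_r} :=
  fun A => `[< exists s : seq 'I_r, A = word_mx s >].

(* The Weyl group inside GL(Lambda), acting on column vectors, so that        *)
(* (u * v) x = u (v x).                                                       *)
Record weyl := Weyl { weyl_mx :> 'M[int]_r; weyl_mxP : weyl_mx \in weyl_pred }.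

HB.instance Definition _ := [isSub for weyl_mx].
HB.instance Definition _ := [Choice of weyl by <:].

Lemma weyl_predP A : reflect (exists s, A = word_mx s) (A \in weyl_pred).
Proof. exact: asboolP. Qed.

Lemma word_mx_cat s t : word_mx (s ++ t) = word_mx s *m word_mx t.
Proof. by elim: s => [|i s IHs] /=; rewrite ?mul1mx // IHs mulmxA. Qed.

Lemma refl_mxK a : a \in root D -> refl_mx a *m refl_mx a = 1%:M.
Proof.
move=> Ra; rewrite /refl_mx mulmxBl mul1mx mulmxBr mulmx1.
have -> : a *m coroot D a *m (a *m coroot D a) = (a *m coroot D a) *+ 2.
  rewrite -mulmxA [coroot D a *m (_ *m _)]mulmxA.
  rewrite [coroot D a *m a]mx11_scalar -/(pairing _ _) pairing_coroot //.
  by rewrite mul_scalar_mx -scalemxAr scaler_nat.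
by rewrite mulr2n opprB addrK subrK.
Qed.

Lemma word_mx_rev s : word_mx (rev s) *m word_mx s = 1%:M.
Proof.
elim: s => [|i s IHs] /=; first by rewrite mul1mx.
rewrite rev_cons -cats1 word_mx_cat /= mulmx1 -mulmxA.
rewrite [refl_mx _ *m (_ *m _)]mulmxA refl_mxK ?mul1mx //; exact: simple_root.
Qed.

Lemma weyl1_subproof : 1%:M \in weyl_pred.
Proof. by apply/weyl_predP; exists [::]. Qed.

Lemma weylM_subproof (u v : weyl) : u *m v \in weyl_pred.
Proof.
have [[s ->] [t ->]] := (weyl_predP _ (weyl_mxP u), weyl_predP _ (weyl_mxP v)).
by apply/weyl_predP; exists (s ++ t); rewrite word_mx_cat.
Qed.

Lemma weyl_unit (u : weyl) : weyl_mx u \in unitmx.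
Proof.
have /weyl_predP[s ->] := weyl_mxP u.
by have /mulmx1_unit[] := word_mx_rev s.
Qed.

Lemma weylV_subproof (u : weyl) : invmx u \in weyl_pred.
Proof.
have := weyl_unit u; have /weyl_predP[s ->] := weyl_mxP u => Us.
apply/weyl_predP; exists (rev s).
by rewrite -[LHS]mul1mx -(word_mx_rev s) mulmxK.
Qed.

Lemma srefl_subproof i : refl_mx (simple D i) \in weyl_pred.
Proof. by apply/weyl_predP; exists [:: i]; rewrite /= mulmx1. Qed.

Lemma weyl_root (u : weyl) a : a \in root D -> u *m a \in root D.
Proof.
move=> Ra; have /weyl_predP[s ->] := weyl_mxP u.
elim: s => [|i s IHs] /=; first by rewrite mul1mx.
by rewrite -mulmxA refl_mxE root_stable // simple_root.
Qed.

Definition weyl_code (u : weyl) : {ffun 'I_(size (root D)) -> 'I_(size (root D)).+1} :=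
  [ffun k : 'I_(size (root D)) => inord (index (u *m nth 0 (root D) k) (root D))].

Lemma weyl_code_inj : injective weyl_code.
Proof.
move=> u v /ffunP Euv; apply: val_inj => /=.
have Er a : a \in root D -> u *m a = v *m a.
  move=> Ra; have lta : (index a (root D) < size (root D))%N by rewrite index_mem.
  have /(congr1 val) := Euv (Ordinal lta); rewrite !ffunE /= !nth_index //.
  rewrite !inordK ?ltnS ?index_size // => Ei.
  rewrite -[LHS](nth_index 0 (weyl_root u Ra)) Ei nth_index //; exact: weyl_root.
apply/matrixP => k j; rewrite -[weyl_mx u]mulmx1 -[weyl_mx v]mulmx1.
set x := col j (1%:M : 'M[int]_r).
have [n [c [n0 Ex]]] := root_semisimple D x.
have: n *: (u *m x) = n *: (v *m x).
  rewrite !scalemxAr Ex !mulmx_sumr big_seq [RHS]big_seq.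
  by apply: eq_bigr => a Ra; rewrite -!scalemxAr Er.
move/matrixP/(_ k ord0); rewrite [LHS]mxE [RHS]mxE => /(mulfI n0).
rewrite !mxE; under eq_bigr do rewrite mxE.
by under [in RHS]eq_bigr do rewrite mxE.
Qed.

Definition weyl_decode f : option weyl :=
  if pselect (exists u, weyl_code u = f) is left ex then Some (projT1 (cid ex))
  else None.

Lemma weyl_codeK : pcancel weyl_code weyl_decode.
Proof.
move=> u; rewrite /weyl_decode; case: pselect => [ex|[]]; last by exists u.
by congr Some; apply: weyl_code_inj; exact: projT2 (cid ex).
Qed.

HB.instance Definition _ := [Countable of weyl by <:].
HB.instance Definition _ : isFinite weyl := PCanIsFinite weyl_codeK.

Definition weyl_one := Weyl weyl1_subproof.
Definition weyl_mul u v := Weyl (weylM_subproof u v).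
Definition weyl_inv u := Weyl (weylV_subproof u).

Lemma weyl_mulA : associative weyl_mul.
Proof. by move=> u v w; apply: val_inj; rewrite /= mulmxA. Qed.
Lemma weyl_mul1 : left_id weyl_one weyl_mul.
Proof. by move=> u; apply: val_inj; rewrite /= mul1mx. Qed.
Lemma weyl_mulV : left_inverse weyl_one weyl_inv weyl_mul.
Proof. by move=> u; apply: val_inj; rewrite /= mulVmx ?weyl_unit. Qed.

HB.instance Definition _ := Finite_isGroup.Build weyl
  weyl_mulA weyl_mul1 weyl_mulV.

Definition srefl (i : 'I_r) : weyl := Weyl (srefl_subproof i).

Local Open Scope group_scope.

Lemma weyl_wordP (u : weyl) :
  exists n, [exists s : n.-tuple 'I_r, u == \prod_(i <- s) srefl i].
Proof.
have /weyl_predP[s Es] := weyl_mxP u.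
exists (size s); apply/existsP; exists (in_tuple s); apply/eqP/val_inj => /=.
by rewrite Es; elim: s {Es} => [|i s /= ->]; rewrite ?big_nil // big_cons.
Qed.

Definition weyl_length (u : weyl) : nat := ex_minn (weyl_wordP u).

Lemma weyl_redwordP (u : weyl) :
  exists s : (weyl_length u).-tuple 'I_r, u == \prod_(i <- s) srefl i.
Proof. by rewrite /weyl_length; case: ex_minnP => n /existsP. Qed.

(* a chosen reduced expression of u *)
Definition redword (u : weyl) : (weyl_length u).-tuple 'I_r :=
  xchoose (weyl_redwordP u).

(* Bruhat order: generated by u < u t for t a reflection, i.e. a conjugate of *)
(* a simple reflection, such that l(u) < l(u t).                              *)
Definition bruhat : rel weyl :=
  connect [rel u v : weyl |
    [exists x : weyl, exists i : 'I_r, v == u * (srefl i ^ x)]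
    && (weyl_length u < weyl_length v)%N].

Definition bruhat_lt : rel weyl := [rel u v | (u != v) && bruhat u v].

Definition longest : weyl := [arg max_(u > 1 : weyl) weyl_length u].

End WeylGroup.

Section Coefficients.
Variable r : nat.

(* Z[Lambda] is the ring of Laurent polynomials over Z in x_j = e^{eps_j}     *)
(* (eps_j the standard basis of Lambda), so its quotient field is that of the *)
(* polynomial ring Z[x_1, .., x_r].                                           *)
Definition fracZL := {fraction {mpoly int[r]}}.

Definition expL (x : 'cV[int]_r) : fracZL :=
  \prod_(j < r) FracField.tofrac ('X_j : {mpoly int[r]}) ^ x j ord0.

Lemma expL0 : expL 0 = 1.
Proof. by rewrite /expL big1 // => j _; rewrite mxE expr0z. Qed.

Lemma expLD x y : expL (x + y) = expL x * expL y.
Proof.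
rewrite /expL -big_split; apply: eq_bigr => j _ /=.
by rewrite mxE expfzDr // tofrac_eq0 -msupp_eq0 msuppX.
Qed.

Lemma expL_mnm (m : 'X_{1..r}) :
  expL (\col_j (m j)%:Z) = FracField.tofrac 'X_[m].
Proof.
rewrite mpolyXE_id rmorph_prod; apply: eq_bigr => j _ /=.
by rewrite mxE rmorphXn.
Qed.

(* Q_{t1,t2}(Lambda) = Z[t1,t2] (x) Q(Z[Lambda]) *)
Definition coefQ := {mpoly fracZL[2]}.

Definition t1 : coefQ := 'X_(@ord0 1).
Definition t2 : coefQ := 'X_(@ord_max 1).

Definition E (x : 'cV[int]_r) : coefQ := (expL (- x) - 1)%:MP.

End Coefficients.
Arguments t1 {r}.
Arguments t2 {r}.

Section Hecke.
Variables (r : nat) (D : rootDatum r).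

Definition hecke_relations (A : algType (coefQ r)) (h : 'I_r -> A) : Prop :=
  (forall i, (h i - t1%:A) * (h i - t2%:A) = 0) /\
  (forall i j, let m := #[srefl D i * srefl D j]%g in
    \prod_(k < m) h (if odd k then j else i) =
    \prod_(k < m) h (if odd k then i else j)).

(* (H, h) is the algebra presented by the generators h_i and the above        *)
(* relations.                                                                 *)
Definition is_hecke_algebra (H : algType (coefQ r)) (h : 'I_r -> H) : Prop :=
  [/\ hecke_relations h,
      forall S : {pred H}, GRing.subalg_closed S ->
        (forall i, h i \in S) -> forall x, x \in S
    & forall (A : algType (coefQ r)) (f : 'I_r -> A), hecke_relations f ->
        exists phi : {lrmorphism H -> A}, forall i, phi (h i) = f i].

Variables (H : algType (coefQ r)) (h : 'I_r -> H).

Definition hecke_basis (w : weyl D) : H := \prod_(i <- redword w) h i.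

(* The W-action on coefficients only enters through w'(E(alpha_i)), which is  *)
(* E(w' alpha_i).                                                             *)
Definition is_yang_baxter_basis (Y : weyl D -> H) : Prop :=
  Y 1%g = 1 /\
  forall (w' : weyl D) (i : 'I_r), bruhat_lt w' (w' * srefl D i)%g ->
    Y (w' * srefl D i)%g =
    Y w' * (h i + ((t1 + t2) / E (w' *m simple D i))%:A).

Definition is_transition (B C : weyl D -> H) (p : weyl D -> weyl D -> coefQ r) :=
  (forall v, B v = \sum_(w | bruhat w v) p w v *: C w) /\
  (forall w v, ~~ bruhat w v -> p w v = 0).

End Hecke.

(* Main.v *)
Require Import Defs.
From mathcomp Require Import all_boot all_order all_algebra all_fingroup.
From mathcomp Require Import cyclic boolp zify ring.

(** The proof compares two recurrences along right multiplication by simple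
    reflections.

    In the Hecke algebra the basis [h_w] obeys the usual rule for [h_w h_i]
    ([hecke_basisM]), and the definition of the Yang-Baxter basis gives
    [Y_w h_i] as a combination of [Y_{w s_i}] and [Y_w] ([yang_baxterM]): for an
    ascent this is the definition, and for a descent it holds because the two
    parameters attached to [w alpha_i] and [- w alpha_i] add up to
    [- (t1 + t2)], a property of [E] ([E_inv_sum]).

    Expanding [Y_y h_i] in the basis [h] in two ways gives a recurrence for [p]
    in its lower index ([transition_srefl]). Put
    [q(w, v) = (-1)^(l(v) + l(w)) p(v w0, w w0)]. Right multiplication by [w0]
    complements lengths, reverses descents, and replaces [alpha_i] by
    [- alpha_j] where [s_i w0 = w0 s_j] ([longest_simple]), so the recurrence
    for [p] becomes a recurrence for [q] in its upper index
    ([dual_coef_srefl]). It is exactly the one satisfied by the coefficients of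
    [h_v h_i] in the Yang-Baxter basis. Hence [h_v = sum_w q(w, v) Y_w] by
    induction on the length of [v] ([hecke_basis_dual]); the base case is the
    triangularity of [p]. Since a right inverse of the square matrix [p] is
    unique, [q] is the inverse transition matrix ([transition_unique]).

    Two facts on the Hecke algebra are needed. That [h_v h_i = h_{v s_i}] for
    an ascent is Matsumoto's theorem ([matsumoto]). That the [h_w] are linearly
    independent ([hecke_basis_free]) follows from the regular representation:
    the candidate operators of right multiplication on the free module over the
    Weyl group commute with those of left multiplication, which act
    transitively on the basis, so the braid relations need only be checked on
    the identity element ([right_mx_braid]).

    Both rest on the equivalence between descents of length and signs of roots
    ([descentE]). The exchange property behind it needs the conjugate of a
    reflection by a Weyl group element to be the reflection in the image root,
    which is derived from the finiteness of the root system
    ([coroot_unique]). *)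

Set Implicit Arguments.
Unset Strict Implicit.
Unset Printing Implicit Defensive.

Import Order.TTheory GRing.Theory Num.Theory.
Local Open Scope ring_scope.

(** * Coroots, positive roots and lengths *)

Section Descents.
Variables (r : nat) (D : rootDatum r).
Implicit Types (a b x : 'cV[int]_r) (u v w : weyl D) (i j : 'I_r).

Local Notation s := (srefl D).
Local Notation alpha := (simple D).
Local Notation R := (Defs.root D).

Lemma pairingZ (f : 'rV[int]_r) n a : pairing f (n *: a) = n * pairing f a.
Proof. by rewrite /pairing -scalemxAr mxE. Qed.

Lemma pairingD (f : 'rV[int]_r) a b :
  pairing f (a + b) = pairing f a + pairing f b.
Proof. by rewrite /pairing mulmxDr mxE. Qed.

(** Every lattice vector has a nonzero multiple in the span of the roots, so a
    functional on the lattice is determined by its values on the roots. *)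
Lemma root_pairing_ext (f g : 'rV[int]_r) :
  {in R, pairing f =1 pairing g} -> f = g.
Proof.
move=> fg; apply/rowP => k.
pose x : 'cV[int]_r := delta_mx k 0.
have [n [c [n0 Ex]]] := root_semisimple D x.
have coordE (h : 'rV[int]_r) : pairing h x = h 0 k.
  by rewrite /pairing -colE mxE; congr (h _ _); apply: val_inj.
rewrite -!coordE; apply: (mulfI n0).
have lin (h : 'rV[int]_r) : n * pairing h x = \sum_(a <- R) c a * pairing h a.
  rewrite -pairingZ Ex /pairing mulmx_sumr summxE.
  by apply: eq_bigr => a _; exact: pairingZ.
rewrite !lin big_seq [RHS]big_seq.
by apply: eq_bigr => a Ra; rewrite fg.
Qed.

(** Only one reflection with root [a] can preserve the root system: composing
    two of them gives the transvection [b |-> b + g b *: a], [g] being the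
    difference of the functionals, and its iterates would produce infinitely
    many roots unless [g] vanishes. *)
Lemma coroot_unique a (f : 'rV[int]_r) : a \in R -> pairing f a = 2 ->
  (forall b, b \in R -> b - pairing f b *: a \in R) ->
  f = coroot D a.
Proof.
move=> Ra fa2 fR; apply: root_pairing_ext => b Rb.
pose g := f - coroot D a.
have pgE x : pairing g x = pairing f x - pairing (coroot D a) x.
  by rewrite /pairing mulmxBl !mxE.
(* The iterates of the transvection, applied to b. *)
have trans n : b + (n%:Z * pairing g b) *: a \in R.
  elim: n => [|n IHn]; first by rewrite mul0r scale0r addr0.
  have := root_stable Ra (fR _ IHn).
  congr (_ \in R).
  rewrite -!scaleNr -!addrA -!scalerDl; congr (_ + _ *: a).
  rewrite !pairingD !pairingZ !pgE fa2 pairing_coroot //; lia.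
have [/eqP|g0] := eqVneq (pairing g b) 0; first by rewrite pgE subr_eq0 => /eqP.
pose t := [seq b + (n%:Z * pairing g b) *: a | n <- iota 0 (size R).+1].
have: (size t <= size R)%N.
  apply: uniq_leq_size => [|x /mapP[n _ ->]]; last exact: trans.
  rewrite map_inj_uniq ?iota_uniq // => m n /addrI/eqP.
  rewrite -subr_eq0 -scalerBl -mulrBl => /eqP e0.
  have : pairing (coroot D a) 0 = 0 by rewrite /pairing mulmx0 mxE.
  rewrite -e0 pairingZ pairing_coroot // => /eqP.
  by rewrite !mulf_eq0 (negPf g0) orbF /= orbF subr_eq0 => /eqP [].
by rewrite size_map size_iota ltnn.
Qed.

Lemma weyl_act u v a : (u * v)%g *m a = u *m (v *m a).
Proof. by rewrite /= mulmxA. Qed.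

Lemma weyl_act1 a : (1%g : weyl D) *m a = a.
Proof. by rewrite /= mul1mx. Qed.

Lemma weyl_actK u a : (u^-1)%g *m (u *m a) = a.
Proof. by rewrite -weyl_act mulVg weyl_act1. Qed.

Lemma weyl_actKV u a : u *m ((u^-1)%g *m a) = a.
Proof. by rewrite -weyl_act mulgV weyl_act1. Qed.

(** The conjugate by [u] of the reflection in [a] preserves the roots and
    negates [u a], so it is the reflection in [u a]. *)
Lemma coroot_act u a : a \in R ->
  coroot D (u *m a) = coroot D a *m (u^-1)%g.
Proof.
move=> Ra; apply/esym/coroot_unique; first exact: weyl_root.
  by rewrite /pairing -mulmxA weyl_actK; exact: pairing_coroot.
move=> b Rb; set n := pairing _ _.
have -> : b - n *: (u *m a)
    = u *m ((u^-1)%g *m b - pairing (coroot D a) ((u^-1)%g *m b) *: a).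
  by rewrite mulmxBr weyl_actKV -scalemxAr /n /pairing mulmxA.
by apply/weyl_root/root_stable => //; exact: weyl_root.
Qed.

Lemma srefl_conj u i j : u *m alpha i = alpha j -> (u * s i = s j * u)%g.
Proof.
move=> uij; apply: val_inj; rewrite /= /refl_mx mulmxBr mulmx1 mulmxBl mul1mx.
rewrite mulmxA -uij (coroot_act _ (simple_root D i)) -!mulmxA.
congr (_ - _ *m (_ *m _)).
by rewrite -/(weyl_mx _ *m _) /= mulVmx ?mulmx1 // weyl_unit.
Qed.

Lemma sreflK i : (s i * s i = 1)%g.
Proof. by apply: val_inj; rewrite /= refl_mxK // simple_root. Qed.

Lemma sreflV i : ((s i)^-1 = s i)%g.
Proof. by apply/eqP; rewrite eq_invg_mul sreflK. Qed.

Lemma mulgsK w i : (w * s i * s i = w)%g.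
Proof. by rewrite -mulgA sreflK mulg1. Qed.

Lemma srefl_simple i : s i *m alpha i = - alpha i.
Proof.
rewrite refl_mxE pairing_coroot ?simple_root //.
by rewrite scaler_nat mulr2n opprD addNKr.
Qed.

Definition positive a : bool :=
  `[< exists c : 'I_r -> nat, a = \sum_i alpha i *+ c i >].

Lemma simple_coord_inj (c d : 'I_r -> int) :
  \sum_i c i *: alpha i = \sum_i d i *: alpha i -> c =1 d.
Proof.
move=> /eqP; rewrite -subr_eq0 -sumrB => /eqP e i; apply/eqP; rewrite -subr_eq0.
apply/eqP; apply: (@simple_free _ D (fun i => c i - d i)).
by rewrite -[RHS]e; apply: eq_bigr => k _; rewrite scalerBl.
Qed.

Lemma sum_nat_simple (c : 'I_r -> nat) :
  \sum_i alpha i *+ c i = \sum_i (c i)%:Z *: alpha i.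
Proof. by apply: eq_bigr => i _; rewrite -scaler_nat natz. Qed.

Lemma simple_sum i : alpha i = \sum_j (j == i)%:Z *: alpha j.
Proof.
rewrite (bigD1 i) //= eqxx scale1r big1 ?addr0 // => j /negPf->.
by rewrite scale0r.
Qed.

Lemma root_neq0 a : a \in R -> a != 0.
Proof.
move=> Ra; apply/eqP => a0; have := pairing_coroot Ra.
by rewrite a0 /pairing mulmx0 mxE.
Qed.

Lemma simple_positive i : positive (alpha i).
Proof.
apply/asboolP; exists (fun j => j == i : nat); rewrite sum_nat_simple.
exact: simple_sum.
Qed.

Lemma root_opp a : a \in R -> - a \in R.
Proof.
move=> Ra; have := root_stable Ra Ra.
by rewrite pairing_coroot // scaler_nat mulr2n opprD addNKr.
Qed.

Lemma positiveN a : a \in R -> positive (- a) = ~~ positive a.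
Proof.
move=> Ra; apply/idP/idP => [/asboolP[d Ed]|].
  apply/negP => /asboolP[c Ec]; case/eqP: (root_neq0 Ra).
  have cd0 : \sum_i (c i + d i)%N%:Z *: alpha i = \sum_i 0 *: alpha i.
    rewrite [RHS]big1 => [|i _]; last by rewrite scale0r.
    rewrite -[RHS](subrr a) Ed [X in X + _]Ec -big_split -sum_nat_simple.
    by apply: eq_bigr => i _; rewrite mulrnDr.
  rewrite Ec big1 // => i _; have /eqP := simple_coord_inj cd0 i.
  by rewrite eqz_nat addn_eq0 => /andP[/eqP-> _]; rewrite mulr0n.
have [c [Ec|Ec]] := simple_base Ra => np.
  by case/negP: np; apply/asboolP; exists c.
by apply/asboolP; exists c; rewrite Ec opprK.
Qed.

(** Pairing with the coroot of [a] shows that [n] divides 2, and [n = 2] is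
    excluded because the root system is reduced. *)
Lemma root_multiple_simple a i n : a \in R -> a = alpha i *+ n ->
  a = alpha i.
Proof.
move=> Ra Ea; have := pairing_coroot Ra.
have -> : pairing (coroot D a) a = n%:Z * pairing (coroot D a) (alpha i).
  by rewrite {2}Ea /pairing -scaler_nat -scalemxAr mxE natz.
move/(congr1 absz); rewrite abszM /= => n2.
have : (n %| 2)%N by rewrite -[2%N]/(1 + 1)%N -n2 dvdn_mulr.
have := root_reduced (simple_root D i).
rewrite Ea in Ra *; move: Ra {Ea n2}.
by case: n => [|[|[|n]]] // ->.
Qed.

(** Reflecting in [alpha i] changes only the [i]-th coordinate. If the sign
    changed, all the other coordinates of [a] would vanish. *)
Lemma srefl_permutes_positive i a : a \in R -> positive a ->
  a != alpha i -> positive (s i *m a).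
Proof.
move=> Ra pa; apply: contraR; rewrite -positiveN; last exact: weyl_root.
case/asboolP: pa => c Ec /asboolP[d Ed].
pose n := pairing (coroot D (alpha i)) a.
have cd : \sum_j (c j + d j)%N%:Z *: alpha j
    = \sum_j (n * (j == i)%:Z) *: alpha j.
  have -> : \sum_j (n * (j == i)%:Z) *: alpha j = n *: alpha i.
    rewrite [in RHS]simple_sum scaler_sumr.
    by apply: eq_bigr => j _; rewrite scalerA.
  have : a - s i *m a = n *: alpha i by rewrite refl_mxE subKr.
  move=> <-; rewrite Ed [X in X + _]Ec -big_split -sum_nat_simple.
  by apply: eq_bigr => j _; rewrite mulrnDr.
apply/eqP/(@root_multiple_simple _ _ (c i)) => //.
rewrite Ec (bigD1 i) //= big1 ?addr0 // => j ji.
have /eqP := simple_coord_inj cd j; rewrite (negPf ji) mulr0.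
by rewrite eqz_nat addn_eq0 => /andP[/eqP-> _]; rewrite mulr0n.
Qed.

(** The root-theoretic form of a right descent; that it means a drop of length
    is [descentE]. *)
Definition descent w i : bool := ~~ positive (w *m alpha i).

Lemma descentM w i : descent (w * s i)%g i = ~~ descent w i.
Proof.
rewrite /descent weyl_act srefl_simple mulmxN positiveN //.
exact/weyl_root/simple_root.
Qed.

(** Left multiplication by [s i] changes the sign of [w alpha_j] only if this
    root is [alpha i] up to sign, in which case [w] conjugates [s j] to [s i].
    The exchange property and the commutation of left and right multiplication
    operators both rest on this. *)
Lemma descent_mull w i j :
  (descent (s i * w)%g j != descent w j) -> (s i * w = w * s j)%g.
Proof.
have up v : ~~ descent v j -> descent (s i * v)%g j -> (s i * v = v * s j)%g.
  rewrite /descent weyl_act negbK => pv; apply: contraNeq => ne.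
  apply: (srefl_permutes_positive _ pv); first exact/weyl_root/simple_root.
  by apply: contraNneq ne => /srefl_conj ->.
case E: (descent w j); case E': (descent _ j) => // _.
  have := up (s i * w)%g; rewrite E' mulgA sreflK mul1g => /(_ isT E) e.
  by rewrite [in RHS]e mulgsK.
by apply: up; rewrite ?E.
Qed.

Local Notation word t := (\prod_(i <- t) s i)%g.

Lemma length_word_le t : (weyl_length (word t) <= size t)%N.
Proof.
rewrite /weyl_length; case: ex_minnP => n _; apply.
by apply/existsP; exists (in_tuple t).
Qed.

Lemma redwordE w : word (redword w) = w.
Proof. by apply/esym/eqP/(xchooseP (weyl_redwordP w)). Qed.

Lemma word_rev t : word (rev t) = (word t)^-1%g.
Proof.
elim: t => [|i t IHt]; first by rewrite !big_nil invg1.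
by rewrite rev_cons big_rcons big_cons invMg IHt sreflV.
Qed.

(** Reading the word from the left, the sign of the image of [alpha i] changes
    at some letter; by [descent_mull] that letter cancels against [s i]. *)
Lemma exchange t i : descent (word t) i ->
  exists t', word t' = (word t * s i)%g /\ size t = (size t').+1.
Proof.
elim: t => [|j t IHt].
  by rewrite /descent big_nil weyl_act1 simple_positive.
rewrite !big_cons => dj.
have [/IHt[t' [Et' st]]|nd] := boolP (descent (word t) i).
  by exists (j :: t'); rewrite big_cons Et' mulgA /= st.
exists t; split => //; rewrite -mulgA -(@descent_mull _ j) ?dj ?(negPf nd) //.
by rewrite mulgA sreflK mul1g.
Qed.

Lemma length_leS w i : (weyl_length (w * s i)%g <= (weyl_length w).+1)%N.
Proof.
have := length_word_le (rcons (redword w) i).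
by rewrite big_rcons redwordE size_rcons size_tuple.
Qed.

Lemma length_descent w i : descent w i ->
  weyl_length w = (weyl_length (w * s i)%g).+1.
Proof.
move=> dw; apply/eqP; rewrite eqn_leq -{1}(mulgsK w i) length_leS /=.
have : descent (word (redword w)) i by rewrite redwordE.
case/exchange => t; rewrite redwordE size_tuple => -[<- ->].
by rewrite ltnS length_word_le.
Qed.

Lemma length_ascent w i : ~~ descent w i ->
  weyl_length (w * s i)%g = (weyl_length w).+1.
Proof. by rewrite -descentM => /length_descent; rewrite mulgsK. Qed.

Lemma descentE w i :
  descent w i = (weyl_length (w * s i)%g < weyl_length w)%N.
Proof.
case: (boolP (descent w i)) => [/length_descent->|/length_ascent->].
  by rewrite ltnSn.
by rewrite ltnNge leqnSn.
Qed.

Lemma length1 : weyl_length (1%g : weyl D) = 0%N.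
Proof. by have := length_word_le [::]; rewrite big_nil leqn0 => /eqP. Qed.

Lemma length_eq0 w : (weyl_length w == 0%N) = (w == 1%g).
Proof.
apply/idP/eqP => [/eqP l0|->]; last by rewrite length1.
by rewrite -(redwordE w) (size0nil (s := redword w)) ?big_nil ?size_tuple.
Qed.

Lemma weyl_ascent_ind (P : weyl D -> Prop) :
  P 1%g -> (forall w i, ~~ descent w i -> P w -> P (w * s i)%g) ->
  forall w, P w.
Proof.
move=> P1 PS w; have [n] := ubnP (weyl_length w); elim: n w => // n IHn w.
rewrite ltnS => lw; have [-> //|w1] := eqVneq w 1%g.
have: word (redword w) = w := redwordE w.
have := size_tuple (redword w); case/lastP: (tval (redword w)) => [|t i] st Et.
  by move/eqP: w1; rewrite -Et big_nil.
have wi : (w * s i)%g = word t by rewrite -Et big_rcons mulgsK.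
have lti : (weyl_length (w * s i)%g < weyl_length w)%N.
  by rewrite wi -st size_rcons ltnS length_word_le.
rewrite -(mulgsK w i); apply: PS; first by rewrite descentM negbK descentE.
exact/IHn/(leq_trans lti).
Qed.

Lemma length_inv w : weyl_length (w^-1)%g = weyl_length w.
Proof.
have le v : (weyl_length (v^-1)%g <= weyl_length v)%N.
  have := length_word_le (rev (redword v)); rewrite size_rev size_tuple.
  by rewrite word_rev redwordE.
by apply/eqP; rewrite eqn_leq le -{1}(invgK w) le.
Qed.

End Descents.

(** * Dihedral subgroups and reduced words *)

Section ReducedWords.
Variables (r : nat) (D : rootDatum r).
Implicit Types (a b x : 'cV[int]_r) (u v w : weyl D) (i j : 'I_r).

Local Notation s := (srefl D).
Local Notation alpha := (simple D).
Local Notation R := (Defs.root D).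
Local Notation word t := (\prod_(i <- t) s i)%g.

Lemma positive_sum (c : 'I_r -> nat) (b : 'I_r -> 'cV[int]_r) :
  (forall i, c i != 0%N -> positive D (b i)) ->
  positive D (\sum_i b i *+ c i).
Proof.
have pos0 : positive D 0.
  by apply/asboolP; exists (fun _ => 0%N); rewrite big1.
have posD x y : positive D x -> positive D y -> positive D (x + y).
  move=> /asboolP[d ->] /asboolP[e ->]; apply/asboolP.
  exists (fun i => d i + e i)%N; rewrite -big_split.
  by apply: eq_bigr => i _; rewrite mulrnDr.
move=> pb; apply: (big_ind (fun x => positive D x)) => // i _; have := pb i.
elim: (c i) => [|n IHn] //= /(_ isT) bi; rewrite mulrS; apply: posD => //.
by case: n IHn => [|n] IHn; [rewrite mulr0n | exact: IHn].
Qed.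

(** The image is a sum of negative roots. *)
Lemma descent_sum w (c : 'I_r -> nat) :
  (\sum_i alpha i *+ c i) \in R -> (forall i, c i != 0%N -> descent w i) ->
  ~~ positive D (w *m \sum_i alpha i *+ c i).
Proof.
move=> Rc dw; rewrite -positiveN; last exact: weyl_root.
rewrite mulmx_sumr -sumrN.
under eq_bigr do rewrite -scaler_nat -scalemxAr -scalerN scaler_nat.
apply: positive_sum => i /dw; rewrite /descent -positiveN //.
exact/weyl_root/simple_root.
Qed.

Fixpoint alt k i j : seq 'I_r := if k is k'.+1 then i :: alt k' j i else [::].

Lemma alt_rcons k i j :
  alt k.+1 i j = rcons (alt k i j) (if odd k then j else i).
Proof.
elim: k i j => [|k IHk] i j //.
rewrite -[LHS]/(i :: alt k.+1 j i) IHk -[alt k.+1 i j]/(i :: alt k j i) /=.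
by rewrite if_neg.
Qed.

Lemma size_alt k i j : size (alt k i j) = k.
Proof. by elim: k i j => //= k IHk i j; rewrite IHk. Qed.

Lemma mem_alt k i j l : l \in alt k i j -> (l == i) || (l == j).
Proof.
elim: k i j => //= k IHk i j; rewrite inE => /orP[->//|/IHk].
by rewrite orbC.
Qed.

Lemma rev_alt k i j : rev (alt k i j) = if odd k then alt k i j else alt k j i.
Proof.
elim: k i j => [|k IHk] i j //; rewrite [in LHS]alt_rcons rev_rcons IHk /=.
by case: (odd k).
Qed.

(** Hence the two alternating words of length [k] agree in the Weyl group
    exactly when [k] is a multiple of the order of [s i * s j]. *)
Lemma alt_quotient k i j :
  (word (alt k i j) * (word (alt k j i))^-1 = (s i * s j) ^+ k)%g.
Proof.
elim: k i j => [|k IHk] i j; first by rewrite /= !big_nil invg1 mulg1.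
rewrite /= !big_cons invMg sreflV mulgA -[(_ * _ * _^-1)%g]mulgA IHk.
elim: k {IHk} => [|k IHk]; first by rewrite !expg0 mulg1 expg1.
by rewrite expgSr [RHS]expgSr -IHk !mulgA.
Qed.

Lemma order_sreflC i j : #[s i * s j]%g = #[s j * s i]%g.
Proof. by rewrite -orderV invMg !sreflV. Qed.

Lemma alt_order i j :
  word (alt #[s i * s j]%g i j) = word (alt #[s i * s j]%g j i).
Proof. by apply/eqP; rewrite eq_mulgV1 alt_quotient expg_order. Qed.

(** If the letter following these [k] were a descent, [descent_mull] would
    identify the two alternating words of length [k], which by
    [alt_quotient] is impossible for [0 < k] below the order of [s i * s j]. *)
Lemma alt_ascent k i j : (k < #[s i * s j]%g)%N ->
  ~~ descent (word (alt k i j)) (if odd k then j else i).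
Proof.
elim: k i j => [|k IHk] i j lkm.
  by rewrite /descent /= big_nil weyl_act1 negbK simple_positive.
have IH : ~~ descent (word (alt k j i)) (if odd k then i else j).
  by apply: IHk; rewrite order_sreflC ltnW.
rewrite /= if_neg big_cons; apply/negP => dk.
have : word (alt k.+1 i j) = word (alt k.+1 j i).
  rewrite [alt _ j i]alt_rcons big_rcons big_cons.
  by apply: descent_mull; rewrite dk (negPf IH).
move/eqP; rewrite eq_mulgV1 alt_quotient -order_dvdn.
by move/(dvdn_leq (ltn0Sn k)); rewrite leqNgt lkm.
Qed.

Lemma word_support t x : exists e : 'I_r -> int,
  (forall l, e l != 0 -> l \in t) /\ word t *m x = x + \sum_l e l *: alpha l.
Proof.
elim: t => [|i t [e [He Ee]]].
  exists (fun _ => 0); split=> [l|]; first by rewrite eqxx.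
  by rewrite big_nil weyl_act1 big1 ?addr0 // => l _; rewrite scale0r.
set n := pairing (coroot D (alpha i)) (word t *m x).
exists (fun l => e l - n * (l == i)%:Z); split=> [l|].
  rewrite inE; have [//|_] := eqVneq l i.
  by rewrite mulr0 subr0; apply: He.
rewrite big_cons weyl_act refl_mxE -/n Ee -addrA; congr (_ + _).
under [RHS]eq_bigr do rewrite scalerBl -scalerA.
by rewrite sumrB -scaler_sumr -simple_sum.
Qed.

(** By [alt_ascent] and [word_support] the alternating word sends the next
    simple root to a positive root supported on [i] and [j], which [w] makes
    negative by [descent_sum]. *)
Lemma alt_descent w k i j : (k < #[s i * s j]%g)%N ->
  descent w i -> descent w j ->
  descent (w * word (alt k i j))%g (if odd k then j else i).
Proof.
move=> lkm di dj; set c := if _ then _ else _; rewrite /descent weyl_act.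
have := alt_ascent lkm; rewrite -/c negbK => /asboolP[d Ed].
have Rd : word (alt k i j) *m alpha c \in R by exact/weyl_root/simple_root.
have [e [He Ee]] := word_support (alt k i j) (alpha c).
have {Ee} de : (fun l => (d l)%:Z) =1 (fun l => (l == c)%:Z + e l).
  apply: (@simple_coord_inj _ D).
  rewrite -sum_nat_simple -Ed Ee [X in X + _]simple_sum.
  by rewrite -big_split; apply: eq_bigr => l _ /=; rewrite scalerDl.
rewrite Ed in Rd *; apply: descent_sum => // l dl.
have : (l == i) || (l == j).
  have [e0|/He/mem_alt//] := eqVneq (e l) 0.
  have := de l; rewrite e0 addr0; case: eqVneq => [->|_ [d0]].
    by rewrite /c; case: ifP => _; rewrite eqxx ?orbT.
  by rewrite d0 in dl.
by case/orP => /eqP->.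
Qed.

Lemma length_dihedral w k i j : (k <= #[s i * s j]%g)%N ->
  descent w i -> descent w j ->
  weyl_length w = (weyl_length (w * word (alt k i j))%g + k)%N.
Proof.
move=> + di dj; elim: k => [|k IHk] lk; first by rewrite big_nil mulg1 addn0.
rewrite (IHk (ltnW lk)) alt_rcons big_rcons mulgA.
by rewrite (length_descent (alt_descent lk di dj)) addSnnS.
Qed.

Definition reduced t := size t == weyl_length (word t).

Lemma reduced_redword w : reduced (redword w).
Proof. by rewrite /reduced redwordE size_tuple. Qed.

Lemma reduced_belast t i : reduced (rcons t i) -> reduced t.
Proof.
rewrite /reduced size_rcons big_rcons eqn_leq => /andP[l1 _].
by rewrite eqn_leq length_word_le andbT -ltnS (leq_trans l1) ?length_leS.
Qed.

Lemma reduced_descent t i : reduced (rcons t i) -> descent (word (rcons t i)) i.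
Proof.
rewrite /reduced descentE => /eqP <-.
by rewrite size_rcons ltnS big_rcons mulgsK length_word_le.
Qed.

(** An element with both [i] and [j] as descents can be stripped of the longest
    element of the dihedral subgroup on its right, so it has a reduced word
    ending with either of the two full alternating words. *)
Lemma dihedral_words w i j : descent w i -> descent w j ->
  exists t, forall t',
    t' = alt #[s i * s j]%g i j \/ t' = alt #[s i * s j]%g j i ->
    word (t ++ rev t') = w /\ reduced (t ++ rev t').
Proof.
move=> di dj; set m := #[_]%g.
exists (redword (w * word (alt m i j))%g) => t' Et'.
have [wt' st'] : word t' = word (alt m i j) /\ size t' = m.
  by case: Et' => ->; rewrite size_alt // alt_order.
have E : word (redword (w * word (alt m i j))%g ++ rev t') = w.
  by rewrite big_cat word_rev /= redwordE wt' mulgK.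
split=> //; rewrite /reduced E size_cat size_rev st' size_tuple.
by rewrite -(length_dihedral (leqnn m)).
Qed.

Section Matsumoto.
Variables (A : pzRingType) (h : 'I_r -> A).
Hypothesis braid : forall i j,
  let m := #[s i * s j]%g in
  \prod_(k < m) h (if odd k then j else i) =
  \prod_(k < m) h (if odd k then i else j).

Lemma prod_alt k i j :
  \prod_(c <- alt k i j) h c = \prod_(l < k) h (if odd l then j else i).
Proof.
elim: k i j => [|k IHk] i j; first by rewrite big_nil big_ord0.
rewrite /= big_cons big_ord_recl IHk; congr (_ * _).
by apply: eq_bigr => l _ /=; rewrite if_neg.
Qed.

Lemma prod_rev_alt i j (m := #[s i * s j]%g) :
  \prod_(c <- rev (alt m i j)) h c = \prod_(c <- rev (alt m j i)) h c.
Proof. by rewrite !rev_alt; case: odd; rewrite !prod_alt braid. Qed.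

(** Matsumoto's theorem, by induction on the length. Two reduced words with the
    same last letter are compared by induction. If the last letters are [i] and
    [j], both words are compared with the two words of [dihedral_words], which
    differ by one braid relation. *)
Lemma matsumoto t t' : word t = word t' -> reduced t -> reduced t' ->
  \prod_(c <- t) h c = \prod_(c <- t') h c.
Proof.
have [n] := ubnP (size t); elim: n t t' => // n IHn t t'.
case/lastP: t => [|t i].
  move=> _ E _; rewrite /reduced -E !big_nil length1 => /nilP ->.
  by rewrite big_nil.
case/lastP: t' => [|t' j].
  by move=> _ E; rewrite /reduced E !big_nil length1 size_rcons.
rewrite size_rcons ltnS => lt E rt rt'.
have same (a b : seq _) k : (size a < n)%N ->
    word (rcons a k) = word (rcons b k) ->
    reduced (rcons a k) -> reduced (rcons b k) ->
  \prod_(c <- rcons a k) h c = \prod_(c <- rcons b k) h c.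
  move=> la; rewrite !big_rcons => /mulIg Eab.
  move=> /reduced_belast ra /reduced_belast rb.
  by rewrite (IHn a b).
have di := reduced_descent rt; have dj := reduced_descent rt'.
rewrite -E in dj; have [t0 Ht0] := dihedral_words di dj.
have [m' Em] : exists m', #[s i * s j]%g = m'.+1.
  by case: #[_]%g (order_gt0 (s i * s j)%g) => // m' _; exists m'.
have [Ei ri] := Ht0 _ (or_introl erefl).
have [Ej rj] := Ht0 _ (or_intror erefl).
have -> : \prod_(c <- rcons t i) h c
    = \prod_(c <- t0 ++ rev (alt #[s i * s j]%g i j)) h c.
  move: Ei ri; rewrite Em /= rev_cons -rcons_cat => Ei ri.
  by apply: same.
rewrite big_cat prod_rev_alt -big_cat.
move: Ej rj; rewrite Em /= rev_cons -rcons_cat => Ej rj.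
apply: same => //; last by rewrite Ej.
move/eqP: rj; rewrite Ej -(eqP rt) !size_rcons => -[->].
by [].
Qed.

Lemma prod_redword_ascent w i : ~~ descent w i ->
  \prod_(c <- redword (w * s i)%g) h c = (\prod_(c <- redword w) h c) * h i.
Proof.
move=> nd; rewrite -big_rcons; apply: matsumoto; rewrite ?reduced_redword //.
  by rewrite big_rcons !redwordE.
by rewrite /reduced big_rcons redwordE size_rcons size_tuple length_ascent.
Qed.

End Matsumoto.

End ReducedWords.

(** * The longest element *)

Section LongestElement.
Variables (r : nat) (D : rootDatum r).
Implicit Types (u v w : weyl D) (i j : 'I_r).

Local Notation s := (srefl D).
Local Notation alpha := (simple D).
Local Notation R := (Defs.root D).

Local Notation w0 := (longest D).

Lemma length_longest u : (weyl_length u <= weyl_length w0)%N.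
Proof. by rewrite /longest; case: arg_maxnP => // v _; apply. Qed.

Lemma descent_longest i : descent w0 i.
Proof.
apply: contraT => /length_ascent l1.
by have := length_longest (w0 * s i)%g; rewrite l1 ltnn.
Qed.

Lemma no_descent u : (forall i, ~~ descent u i) -> u = 1%g.
Proof.
elim/weyl_ascent_ind: u => // w i nd _ /(_ i).
by rewrite descentM nd.
Qed.

Lemma descent_longestV i : descent (w0^-1)%g i.
Proof.
apply/negP => /asboolP[c Ec].
have R0 : (w0^-1)%g *m alpha i \in R by exact/weyl_root/simple_root.
have := @descent_sum _ D w0 c; rewrite -Ec weyl_actKV simple_positive.
by move/(_ R0 (fun i _ => descent_longest i)).
Qed.

(** If [u] makes all simple roots negative, then [u * w0^-1] has no descent,
    since [w0^-1] also exchanges positive and negative roots. *)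
Lemma longest_unique u : (forall i, descent u i) -> u = w0.
Proof.
move=> du; apply/eqP; rewrite eq_mulgV1; apply/eqP/no_descent => i.
rewrite /descent weyl_act negbK; have := descent_longestV i.
have Rb : (w0^-1)%g *m alpha i \in R by exact/weyl_root/simple_root.
rewrite /descent -positiveN // => /asboolP[c Ec].
have Rc : \sum_i alpha i *+ c i \in R by rewrite -Ec root_opp.
have := descent_sum Rc (fun i _ => du i).
by rewrite -positiveN ?weyl_root // -Ec mulmxN opprK.
Qed.

Lemma longestV : (w0^-1 = w0)%g.
Proof. exact/longest_unique/descent_longestV. Qed.

Lemma longest_sqr : (w0 * w0 = 1)%g.
Proof. by rewrite -{1}longestV mulVg. Qed.

Lemma length_mul_le u v :
  (weyl_length (u * v)%g <= weyl_length u + weyl_length v)%N.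
Proof.
have := length_word_le D (redword u ++ redword v).
by rewrite big_cat /= !redwordE size_cat !size_tuple.
Qed.

Lemma length_srefl i : weyl_length (s i) = 1%N.
Proof.
rewrite -[s i]mul1g length_ascent ?length1 //.
by rewrite /descent weyl_act1 negbK simple_positive.
Qed.

(** Any [u] other than [w0] has an ascent, so [w0] is reached from [u] by
    length-increasing steps. *)
Lemma length_longest_compl u :
  (weyl_length (u^-1 * w0)%g + weyl_length u = weyl_length w0)%N.
Proof.
have [n] := ubnP (weyl_length w0 - weyl_length u); elim: n u => // n IHn u ln.
have [/forallP du|] := boolP [forall i, descent u i].
  by rewrite (longest_unique du) mulVg length1.
rewrite negb_forall => /existsP[i nd].
have lu := length_ascent nd.
have {IHn} := IHn (u * s i)%g; rewrite lu invMg sreflV -mulgA.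
have := length_mul_le u (u^-1 * w0)%g; rewrite mulKVg.
have := length_mul_le (s i) (s i * (u^-1 * w0))%g.
rewrite [(s i * (s i * _))%g]mulgA sreflK mul1g length_srefl.
have := length_longest (u * s i)%g; rewrite lu.
move: ln; set x := weyl_length (s i * _)%g; lia.
Qed.

Lemma length_mul_longest u :
  (weyl_length (u * w0)%g + weyl_length u = weyl_length w0)%N.
Proof. by have := length_longest_compl (u^-1)%g; rewrite invgK length_inv. Qed.

(** The length formula gives [w0 * s i * w0] length one, so it is some [s j].
    Then [s j] negates the positive root [- w0 alpha_i], which must therefore
    be [alpha j]. *)
Lemma longest_simple i : exists j,
  (s i * w0 = w0 * s j)%g /\ w0 *m alpha j = - alpha i.
Proof.
have l1 : weyl_length (w0 * s i * w0)%g = 1%N.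
  have := length_mul_longest (w0 * s i)%g.
  by have := length_descent (descent_longest i) => ->; lia.
have [j Ej] : exists j, (w0 * s i * w0)%g = s j.
  have := reduced_redword (w0 * s i * w0)%g; have := redwordE (w0 * s i * w0)%g.
  move: (tval _) => t Et; rewrite /reduced Et l1; move: t Et.
  by case=> [|j [|//]] // <- _; exists j; rewrite big_seq1.
have E : (s i * w0 = w0 * s j)%g by rewrite -Ej !mulgA longest_sqr mul1g.
exists j; split=> //.
have Rb : - (w0 *m alpha j) \in R by exact/root_opp/weyl_root/simple_root.
have pb : positive D (- (w0 *m alpha j)).
  rewrite positiveN; first exact: descent_longest.
  exact/weyl_root/simple_root.
apply: oppr_inj; rewrite opprK; apply: contraTeq pb => ne.
apply/negP => pb; have := srefl_permutes_positive Rb pb ne.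
by rewrite mulmxN -weyl_act E weyl_act srefl_simple mulmxN positiveN // pb.
Qed.

End LongestElement.

(** * The regular representation *)

Section RegularRepresentation.
Variables (r : nat) (D : rootDatum r) (K : comNzRingType) (q1 q2 : K).
Implicit Types (u v w : weyl D) (i j : 'I_r).

Local Notation s := (srefl D).
Local Notation word t := (\prod_(i <- t) s i)%g.
Local Notation n := #|{: weyl D}|.-1.

Lemma card_weyl : #|{: weyl D}| = n.+1.
Proof. by rewrite prednK //; apply/card_gt0P; exists 1%g. Qed.

(** Matrices form an algebra only in the shape [n.+1], hence the cast of
    [enum_rank]. *)
Definition weyl_rank w : 'I_n.+1 := cast_ord card_weyl (enum_rank w).
Definition weyl_val (k : 'I_n.+1) : weyl D :=
  enum_val (cast_ord (esym card_weyl) k).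

Lemma weyl_rankK : cancel weyl_rank weyl_val.
Proof. by move=> w; rewrite /weyl_val cast_ordK enum_rankK. Qed.

Lemma weyl_valK : cancel weyl_val weyl_rank.
Proof. by move=> k; rewrite /weyl_rank enum_valK cast_ordKV. Qed.

Definition basis_row w : 'rV[K]_n.+1 := delta_mx 0 (weyl_rank w).

Definition op_mx (f : weyl D -> 'rV[K]_n.+1) : 'M[K]_n.+1 :=
  \matrix_k f (weyl_val k).

Lemma op_mxE f w : basis_row w *m op_mx f = f w.
Proof. by rewrite -rowE rowK weyl_rankK. Qed.

Lemma op_mx_ext (A B : 'M[K]_n.+1) :
  (forall w, basis_row w *m A = basis_row w *m B) -> A = B.
Proof.
by move=> AB; apply/row_matrixP => k; rewrite !rowE -(weyl_valK k) AB.
Qed.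

Local Notation T := (q1 + q2).
Local Notation d := (- (q1 * q2)).

(** Rows are acted upon on the right: this is the matrix of right multiplication
    by the [i]-th generator in the expected basis indexed by the Weyl group,
    and [left_mx] that of left multiplication. *)
Definition right_mx i := op_mx (fun w =>
  if descent w i then T *: basis_row w + d *: basis_row (w * s i)%g
  else basis_row (w * s i)%g).

Definition left_mx i := op_mx (fun w =>
  if descent w^-1%g i then T *: basis_row w + d *: basis_row (s i * w)%g
  else basis_row (s i * w)%g).

Lemma right_mx_quadratic i :
  (right_mx i - q1%:A) * (right_mx i - q2%:A) = 0.
Proof.
apply: op_mx_ext => w; rewrite [_ * _]/(_ *m _) mulmx0 mulmxA.
rewrite [basis_row w *m _]mulmxBr op_mxE -scalemxAr mulmx1.
have [dw|dw] := ifPn.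
  rewrite mulmxBr !mulmxBl mulmxDl -!scalemxAl !op_mxE descentM dw /= mulgsK.
  rewrite -!scalemxAr !mulmx1.
  move: (basis_row w) (basis_row _) => x y; apply/rowP => k; rewrite !mxE; ring.
rewrite mulmxBr !mulmxBl -!scalemxAl !op_mxE descentM dw (negPf dw) /= mulgsK.
rewrite -!scalemxAr !mulmx1.
move: (basis_row w) (basis_row _) => x y; apply/rowP => k; rewrite !mxE; ring.
Qed.

(** If [s j * w = w * s i], both sides are computed directly. Otherwise, by
    [descent_mull], multiplying on one side does not affect the descents on
    the other side, and the two operators act independently. *)
Lemma right_left_mx_comm i j : right_mx i * left_mx j = left_mx j * right_mx i.
Proof.
apply: op_mx_ext => w; rewrite ![_ * _]/(_ *m _) !mulmxA !op_mxE.
have [e|ne] := eqVneq (s j * w)%g (w * s i)%g.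
  have e' : ((s j * w)^-1 = w^-1 * s j)%g by rewrite invMg sreflV.
  have dd : descent w^-1%g j = descent w i.
    by rewrite !descentE -e' !length_inv e.
  have e2 : (s j * (w * s i) = w)%g by rewrite -e mulgA sreflK mul1g.
  have e3 : (s j * w * s i = w)%g by rewrite e mulgsK.
  have d1 : descent (w * s i)^-1%g j = ~~ descent w i.
    by rewrite -e e' descentM dd.
  have d2 : descent (s j * w)%g i = ~~ descent w i by rewrite e descentM.
  rewrite dd; case: ifP => dw; rewrite ?mulmxDl -?scalemxAl !op_mxE.
    by rewrite d1 d2 dd dw /= e2 e3 e.
  by rewrite d1 d2 dw /= e2 e3 e.
have dR : descent (s j * w)%g i = descent w i.
  by apply: contraNeq ne => /descent_mull ->.
have dL : descent (w * s i)^-1%g j = descent w^-1%g j.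
  apply: contraNeq ne; rewrite invMg sreflV => /descent_mull.
  by move/(congr1 (fun x => x^-1)%g); rewrite !invMg !sreflV invgK => <-.
case: ifP => di; case: ifP => dj;
  rewrite ?mulmxDl -?scalemxAl !op_mxE ?dR ?dL ?di ?dj ?mulgA //.
rewrite !scalerDr !scalerA.
move: (basis_row _) (basis_row _) (basis_row _) (basis_row _) => x y z t.
apply/rowP => k; rewrite !mxE; ring.
Qed.

Lemma right_mx_reduced t : reduced D t ->
  basis_row 1%g *m (\prod_(c <- t) right_mx c) = basis_row (word t).
Proof.
elim/last_ind: t => [|t i IHt] rt; first by rewrite !big_nil mulmx1.
rewrite !big_rcons /= [LHS]mulmxA IHt ?(reduced_belast rt) // op_mxE.
have := reduced_descent rt; rewrite big_rcons descentM => /negPf ->.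
by [].
Qed.

(** An operator commuting with all [right_mx i] is determined by the image of
    the row of the identity; these commuting operators reach every row. *)
Lemma left_mx_transitive w : exists2 L : 'M[K]_n.+1,
  (forall i, right_mx i * L = L * right_mx i) &
  basis_row 1%g *m L = basis_row w.
Proof.
rewrite -(invgK w); elim/weyl_ascent_ind: (w^-1)%g => [|u i nd [L cL EL]].
  by exists 1 => [i|]; rewrite ?mulr1 ?mul1r ?mulmx1 ?invg1.
exists (L * left_mx i) => [j|].
  by rewrite mulrA cL -!mulrA right_left_mx_comm.
by rewrite [_ * _]/(_ *m _) mulmxA EL op_mxE invgK (negPf nd) invMg sreflV.
Qed.

Lemma reduced_alt k i j : (k <= #[s i * s j]%g)%N -> reduced D (alt k i j).
Proof.
elim: k => [|k IHk] lk; first by rewrite /reduced big_nil length1.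
rewrite alt_rcons /reduced size_rcons big_rcons.
by rewrite length_ascent ?alt_ascent // eqSS; exact/IHk/ltnW.
Qed.

(** Both sides send the row of the identity to the row of the same element,
    because alternating words up to the order of [s i * s j] are reduced. The
    operators of [left_mx_transitive] carry this to all the rows. *)
Lemma right_mx_braid i j : let m := #[s i * s j]%g in
  \prod_(k < m) right_mx (if odd k then j else i) =
  \prod_(k < m) right_mx (if odd k then i else j).
Proof.
move=> m; rewrite -!prod_alt; apply: op_mx_ext => w.
have [L cL <-] := left_mx_transitive w.
have cX t : L *m (\prod_(c <- t) right_mx c) = (\prod_(c <- t) right_mx c) *m L.
  apply: (big_ind (fun X => L *m X = X *m L)) => [|X Y cX cY|c _].
  - by rewrite mulmx1 mul1mx.
  - by rewrite [X * Y]/(X *m Y) mulmxA cX -!mulmxA cY.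
  - exact/esym/cL.
rewrite -!mulmxA !cX !mulmxA !right_mx_reduced ?alt_order //.
  by apply: reduced_alt; rewrite order_sreflC.
exact: reduced_alt.
Qed.

End RegularRepresentation.

(** * The standard basis of the Hecke algebra *)

Section Hecke.
Variables (r : nat) (D : rootDatum r) (H : algType (coefQ r)) (h : 'I_r -> H).
Hypothesis hH : is_hecke_algebra D h.
Implicit Types (u v w : weyl D) (i j : 'I_r).
Local Notation s := (srefl D).
Local Notation hb := (hecke_basis h).

(** By the presentation, the Hecke algebra acts through the matrices [right_mx],
    and [h_w] sends the row of the identity to the row of [w]. *)
Lemma hecke_basis_free (c c' : weyl D -> coefQ r) :
  \sum_w c w *: hb w = \sum_w c' w *: hb w -> c =1 c'.
Proof.
have [_ _ /(_ _ (right_mx D t1 t2))[]] := hH.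
  split; [exact: right_mx_quadratic | exact: right_mx_braid].
move=> phi phiE E w.
pose b0 : 'rV_#|{: weyl D}|.-1.+1 := basis_row (coefQ r) 1%g.
have phi_hb u : b0 *m phi (hb u) = basis_row (coefQ r) u.
  rewrite /hecke_basis rmorph_prod -[in RHS](redwordE u).
  rewrite -(right_mx_reduced t1 t2 (reduced_redword u)); congr (_ *m _).
  by apply: eq_bigr => i _; exact: phiE.
have coordE (e : weyl D -> coefQ r) :
    (b0 *m phi (\sum_u e u *: hb u)) 0 (weyl_rank w) = e w.
  rewrite linear_sum mulmx_sumr summxE (bigD1 w) //= big1 => [|u uw].
    by rewrite linearZ -scalemxAr phi_hb !mxE !eqxx mulr1 addr0.
  rewrite linearZ -scalemxAr phi_hb !mxE eqxx /=.
  rewrite (inj_eq (can_inj (@weyl_rankK _ D))) eq_sym (negPf uw).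
  by rewrite mulr0.
by rewrite -[LHS]coordE E coordE.
Qed.

Lemma hecke_sqr i : h i * h i = (t1 + t2) *: h i - (t1 * t2) *: 1.
Proof.
have [[quad _] _ _] := hH.
apply/eqP; rewrite -subr_eq0 -[X in _ == X](quad i) mulrBl !mulrBr; apply/eqP.
rewrite -!scalerAl -!scalerAr !mul1r !mulr1 !scalerA scalerDl.
by rewrite !opprB !opprD -!addrA; congr (_ + _); rewrite addrA addrC.
Qed.

(** Matsumoto's theorem makes the case of an ascent independent of the chosen
    reduced words; the case of a descent follows from the quadratic relation. *)
Lemma hecke_basisM w i : hb w * h i =
  if descent w i then (t1 + t2) *: hb w - (t1 * t2) *: hb (w * s i)%g
  else hb (w * s i)%g.
Proof.
have [[_ braid] _ _] := hH.
have up u : ~~ descent u i -> hb u * h i = hb (u * s i)%g.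
  by move=> nd; rewrite /hecke_basis (prod_redword_ascent braid nd).
have [dw|] := ifPn; last exact: up.
have -> : hb w = hb (w * s i)%g * h i by rewrite up ?descentM ?dw // mulgsK.
by rewrite -mulrA hecke_sqr mulrBr -!scalerAr mulr1.
Qed.

End Hecke.

(** * The Yang-Baxter parameters *)

Section Coefficients.
Variable r : nat.

Lemma inv_sub1_sum (F : fieldType) (x y : F) : x * y = 1 ->
  x - 1 != 0 -> y - 1 != 0 -> (x - 1)^-1 + (y - 1)^-1 = -1.
Proof.
move=> xy x1 y1; apply: (mulIf (mulf_neq0 y1 x1)).
rewrite mulrDl [in X in X + _]mulrCA mulVf // mulKf // mulr1.
by rewrite mulN1r mulrBl !mulrBr [y * x]mulrC xy; ring.
Qed.

(** Separating the positive and negative exponents turns [expL a = 1] into an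
    equality of two monomials. *)
Lemma expL_eq1 (a : 'cV[int]_r) : expL a = 1 -> a = 0.
Proof.
move=> a1.
pose pos := [multinom if a j ord0 is Posz n then n else 0%N | j < r].
pose neg := [multinom if a j ord0 is Negz n then n.+1 else 0%N | j < r].
have E : \col_j (pos j)%:Z = a + \col_j (neg j)%:Z.
  apply/colP => j; rewrite !mxE !mnmE.
  by case: (a j 0) => m; rewrite ?addr0 // NegzE addNr.
have := congr1 (@expL r) E; rewrite expLD a1 mul1r !expL_mnm => /eqP.
rewrite tofrac_eq => /eqP/(congr1 (mcoeff pos)); rewrite !mcoeffX eqxx.
case: eqVneq => [En _|_ /eqP]; last by rewrite oner_eq0.
by move: E; rewrite En => /eqP; rewrite eq_sym -subr_eq0 addrK => /eqP.
Qed.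

(** With [x = e^{-a}], this is [1/(x - 1) + 1/(x^-1 - 1) = -1]. *)
Lemma E_inv_sum (a : 'cV[int]_r) : a != 0 ->
  (E a)^-1 + (E (- a))^-1 = -1 :> coefQ r.
Proof.
move=> a0; have e : expL (- a) * expL a = 1 by rewrite -expLD addNr expL0.
have n1 : expL a - 1 != 0.
  by rewrite subr_eq0; apply: contra a0 => /eqP/expL_eq1->.
have n2 : expL (- a) - 1 != 0.
  rewrite subr_eq0; apply: contra a0 => /eqP/expL_eq1/eqP.
  by rewrite oppr_eq0.
have fracE := inv_sub1_sum e n2 n1.
rewrite /E opprK -[LHS]/((_%:MP)^-1 + (_%:MP)^-1) -!fmorphV -rmorphD /= fracE.
by rewrite rmorphN rmorph1.
Qed.

End Coefficients.

(** * Recurrences and duality *)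

(** The terms in [b (w * s i)] are collected by the reindexing [w |-> w s_i],
    which turns ascents into descents. *)
Lemma sum_basis_srefl (r : nat) (D : rootDatum r) (K : comNzRingType)
  (A : algType K) (b : weyl D -> A) (g : A) (T d : K) (i : 'I_r) :
  (forall w, b w * g = if descent w i then T *: b w - d *: b (w * srefl D i)%g
                       else b (w * srefl D i)%g) ->
  forall c : weyl D -> K,
  (\sum_w c w *: b w) * g =
  \sum_w (if descent w i then T * c w + c (w * srefl D i)%g
          else - d * c (w * srefl D i)%g) *: b w.
Proof.
move=> bg c.
have sK : involutive (fun w => w * srefl D i)%g by move=> w; rewrite mulgsK.
pose x w := if descent w i then T * c w else 0.
pose y w := if descent w i then - d * c w else c w.
have -> : (\sum_w c w *: b w) * g
    = \sum_w x w *: b w + \sum_w y w *: b (w * srefl D i)%g.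
  rewrite mulr_suml -big_split; apply: eq_bigr => w _ /=.
  rewrite -scalerAl bg /x /y; case: ifP => _; last by rewrite scale0r add0r.
  by rewrite scalerBr !scalerA mulNr scaleNr ![c w * _]mulrC.
rewrite [X in _ + X](reindex_inj (inv_inj sK)) -big_split.
apply: eq_bigr => w _ /=; rewrite mulgsK -scalerDl; congr (_ *: _).
by rewrite /x /y descentM; case: ifP => _ //; rewrite add0r.
Qed.

Lemma signrS (K : pzRingType) n : (-1) ^+ n.+1 = - (-1) ^+ n :> K.
Proof. by rewrite exprS mulN1r. Qed.

Lemma signr_subz (K : unitRingType) m n :
  (-1) ^+ (m + n) = (-1) ^ (m%:Z - n%:Z) :> K.
Proof. by rewrite exprD exprzDr ?unitrN1 // -exprnN -exprVn invrN1. Qed.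

Section YangBaxter.
Variables (r : nat) (D : rootDatum r) (H : algType (coefQ r)) (h : 'I_r -> H).
Hypothesis hH : is_hecke_algebra D h.
Variable Y : weyl D -> H.
Hypothesis hY : is_yang_baxter_basis h Y.
Variable p : weyl D -> weyl D -> coefQ r.
Hypothesis hp : is_transition Y (hecke_basis h) p.
Implicit Types (u v w x y : weyl D) (i j : 'I_r).
Local Notation s := (srefl D).
Local Notation alpha := (simple D).
Local Notation hb := (hecke_basis h).
Local Notation w0 := (longest D).
Local Notation len := (@weyl_length r D).

Lemma bruhat_length u v : bruhat u v -> (len u <= len v)%N.
Proof.
case/connectP => t + ->; elim: t u => //= x t IHt u /andP[/andP[_ ux]].
by move/IHt; apply/leq_trans/ltnW.
Qed.

Lemma bruhat_srefl w i : ~~ descent w i -> bruhat_lt w (w * s i)%g.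
Proof.
move=> /length_ascent lw; apply/andP; split.
  by apply: contraTneq (ltnSn (len w)) => {1}->; rewrite lw ltnn.
apply/connect1/andP; split; last by rewrite lw.
by apply/existsP; exists 1%g; apply/existsP; exists i; rewrite conjg1.
Qed.

Lemma transition_sum (B C : weyl D -> H) (q : weyl D -> weyl D -> coefQ r) v :
  is_transition B C q -> B v = \sum_w q w v *: C w.
Proof.
move=> [-> q0]; rewrite [RHS](bigID (fun w => bruhat w v)) /=.
by rewrite [X in _ + X]big1 ?addr0 // => w /q0 ->; rewrite scale0r.
Qed.

(** The shift in the factor [h_i + yb_param w i] that leads from [Y_w] to
    [Y_{w s_i}]. *)
Definition yb_param w i : coefQ r := (t1 + t2) / E (w *m alpha i).

(** This is where the choice of [E] enters: the factors attached to [w] and to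
    [w s_i] have product a scalar, namely the first value of [yb_step]. *)
Lemma yb_srefl w i : yb_param (w * s i)%g i = - (t1 + t2) - yb_param w i.
Proof.
have Ra : w *m alpha i \in Defs.root D by exact/weyl_root/simple_root.
rewrite /yb_param weyl_act srefl_simple mulmxN.
have /(canRL (addKr _)) -> := E_inv_sum (root_neq0 Ra).
by rewrite mulrDr mulrN mulrN1 addrC.
Qed.

Definition yb_step w i : coefQ r :=
  if descent w i then yb_param w i * yb_param (w * s i)%g i - t1 * t2 else 1.

Lemma yang_baxterM w i :
  Y w * h i = yb_step w i *: Y (w * s i)%g - yb_param w i *: Y w.
Proof.
have up u : ~~ descent u i -> Y u * h i = Y (u * s i)%g - yb_param u i *: Y u.
  move=> /bruhat_srefl lt; have [_ /(_ _ _ lt) ->] := hY.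
  by rewrite mulrDr -scalerAr mulr1 addrK.
rewrite /yb_step; have [dw|nd] := ifPn; last by rewrite scale1r up.
have nd : ~~ descent (w * s i)%g i by rewrite descentM dw.
(* For a descent, Y_w is itself obtained from Y_{w s_i}. *)
have Yw : Y w = Y (w * s i)%g * h i + yb_param (w * s i)%g i *: Y (w * s i)%g.
  by rewrite up // mulgsK subrK.
have ybE : t1 + t2 + yb_param (w * s i)%g i = - yb_param w i.
  by rewrite yb_srefl addNKr.
rewrite Yw mulrDl -scalerAl -mulrA (hecke_sqr hH) mulrBr -!scalerAr mulr1.
rewrite addrAC -scalerDl ybE scalerBl scalerDr !scalerA scaleNr opprD.
by rewrite [RHS]addrC addrA subrK.
Qed.

(** Compare the coefficients of [h_x] in the two expansions of [Y_y h_i]. *)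
Lemma transition_srefl x y i : descent x i ->
  p (x * s i)%g y
    = yb_step y i * p x (y * s i)%g + yb_param (y * s i)%g i * p x y.
Proof.
move=> dx.
have E : (\sum_w p w y *: hb w) * h i
    = \sum_w (yb_step y i * p w (y * s i)%g - yb_param y i * p w y) *: hb w.
  rewrite -(transition_sum y hp) yang_baxterM !(transition_sum _ hp).
  rewrite !scaler_sumr -sumrB.
  by apply: eq_bigr => w _; rewrite scalerBl !scalerA.
rewrite (sum_basis_srefl (fun w => hecke_basisM hH w i)) in E.
have := hecke_basis_free hH E x.
by rewrite dx => /(canRL (addKr _)) ->; rewrite yb_srefl; ring.
Qed.

Lemma sum_delta (C : weyl D -> H) v : \sum_w (w == v)%:R *: C w = C v.
Proof.
rewrite (bigD1 v) //= eqxx scale1r big1 ?addr0 // => w /negPf ->.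
by rewrite scale0r.
Qed.

Lemma transition_eq0 x y : (len y < len x)%N -> p x y = 0.
Proof.
move=> l; have [_ ->] := hp; rewrite //.
by apply: contraL l => /bruhat_length; rewrite leqNgt.
Qed.

Lemma hecke_basis1 : hb (1%g : weyl D) = 1.
Proof.
have /nilP E : nilp (redword (1%g : weyl D)).
  by rewrite /nilp size_tuple length1.
by rewrite /hecke_basis E big_nil.
Qed.

Lemma transition_diag w : p w w = 1.
Proof.
elim/(@weyl_ascent_ind _ D): w => [|w i nd pw].
  have E : \sum_w p w 1%g *: hb w = \sum_(w : weyl D) (w == 1%g)%:R *: hb w.
    by rewrite -(transition_sum _ hp) sum_delta hecke_basis1; case: hY.
  by rewrite (hecke_basis_free hH E) eqxx.
have := @transition_srefl (w * s i)%g w i; rewrite descentM nd mulgsK pw.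
rewrite /yb_step (negPf nd) mul1r (@transition_eq0 _ w) ?length_ascent //.
by rewrite mulr0 addr0 => ->.
Qed.

(** The right-hand side of the duality; the sum of the lengths has the parity of
    their difference and keeps the exponent a natural number. *)
Definition dual_coef w v : coefQ r :=
  (-1) ^+ (len v + len w) * p (v * w0)%g (w * w0)%g.

Lemma descent_mul_longest w i j : w0 *m alpha j = - alpha i ->
  descent (w * w0)%g j = ~~ descent w i.
Proof.
move=> ji; rewrite /descent weyl_act ji mulmxN positiveN //.
exact/weyl_root/simple_root.
Qed.

Lemma yb_mul_longest w i j : w0 *m alpha j = - alpha i ->
  yb_param (w * w0)%g j = yb_param (w * s i)%g i.
Proof. by move=> ji; rewrite /yb_param !weyl_act ji srefl_simple !mulmxN. Qed.

(** Right multiplication by [w0] reverses descents and turns [s i] into [s j],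
    so [transition_srefl] for [p] becomes a recurrence in the upper index [v].
    It is the one that [yang_baxterM] imposes on the coefficients of
    [h_v h_i] in the Yang-Baxter basis. *)
Lemma dual_coef_srefl w v i : ~~ descent v i ->
  dual_coef w (v * s i)%g
    = yb_step (w * s i)%g i * dual_coef (w * s i)%g v
      - yb_param w i * dual_coef w v.
Proof.
move=> nd; have [j [ij ji]] := longest_simple D i.
have mulE u : (u * s i * w0 = u * w0 * s j)%g by rewrite -!mulgA ij.
rewrite /dual_coef mulE transition_srefl; last first.
  by rewrite (descent_mul_longest _ ji).
rewrite -mulE !(yb_mul_longest _ ji) mulgsK.
have -> : yb_step (w * w0)%g j = yb_step (w * s i)%g i.
  rewrite /yb_step (descent_mul_longest _ ji) descentM -mulE.
  by rewrite !(yb_mul_longest _ ji).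
have sgn : (-1) ^+ (len v + len (w * s i)%g)
    = - (-1) ^+ (len v + len w) :> coefQ r.
  have [/length_descent ->|/length_ascent ->] := boolP (descent w i).
    by rewrite addnS [in RHS]signrS opprK.
  by rewrite addnS [in LHS]signrS.
rewrite sgn (length_ascent nd) addSn [in LHS]signrS.
by rewrite mulNr mulrDr !(mulrCA ((-1) ^+ _)) mulNr mulrN opprD.
Qed.

Lemma hecke_basis_dual v : hb v = \sum_w dual_coef w v *: Y w.
Proof.
elim/(@weyl_ascent_ind _ D): v => [|v i nd IHv].
  have [Y1 _] := hY; rewrite hecke_basis1 -Y1 -(sum_delta Y 1%g).
  apply: eq_bigr => w _; congr (_ *: _); rewrite /dual_coef mul1g length1 add0n.
  have [->|w1] := eqVneq; first by rewrite mul1g transition_diag length1 mulr1.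
  rewrite transition_eq0 ?mulr0 //; rewrite -(length_mul_longest w).
  by rewrite -[ltnLHS]addn0 ltn_add2l lt0n length_eq0.
have -> : hb (v * s i)%g = hb v * h i by rewrite (hecke_basisM hH) (negPf nd).
rewrite IHv mulr_suml.
have sK : involutive (fun w => w * s i)%g by move=> w; rewrite mulgsK.
under [RHS]eq_bigr do rewrite dual_coef_srefl // scalerBl.
rewrite sumrB [X in X - _](reindex_inj (inv_inj sK)) -sumrB.
apply: eq_bigr => w _ /=.
rewrite mulgsK -scalerAl yang_baxterM scalerBr !scalerA.
by rewrite ![dual_coef _ _ * _]mulrC.
Qed.

Lemma transition_inverse (a : weyl D -> weyl D -> coefQ r) u v :
  (forall v, hb v = \sum_w a w v *: Y w) ->
  \sum_w p u w * a w v = (u == v)%:R.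
Proof.
move=> aE.
have E : \sum_u (\sum_w p u w * a w v) *: hb u
    = \sum_(u : weyl D) (u == v)%:R *: hb u.
  rewrite sum_delta [RHS]aE.
  under [RHS]eq_bigr do rewrite (transition_sum _ hp) scaler_sumr.
  rewrite exchange_big; apply: eq_bigr => x _; rewrite scaler_suml.
  by apply: eq_bigr => w _; rewrite scalerA mulrC.
exact: (hecke_basis_free hH E u).
Qed.

(** Since [p] is a square matrix with a right inverse, the right inverse is
    unique; this takes the place of the freeness of the Yang-Baxter basis. *)
Lemma transition_unique (a : weyl D -> weyl D -> coefQ r) w v :
  (forall v, hb v = \sum_w a w v *: Y w) -> a w v = dual_coef w v.
Proof.
move=> aE.
(* Index the Weyl group by ordinals to use one-sided inverses of matrices. *)
pose M (c : weyl D -> weyl D -> coefQ r) : 'M_#|{: weyl D}| :=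
  \matrix_(i, j) c (enum_val i) (enum_val j).
have inv b : (forall v, hb v = \sum_w b w v *: Y w) -> M p *m M b = 1%:M.
  move=> bE; apply/matrixP => i j; rewrite !mxE.
  rewrite -(inj_eq enum_val_inj) -(transition_inverse _ _ bE).
  rewrite [RHS](reindex _ (onW_bij _ (@enum_val_bij (weyl D)))) /=.
  by apply: eq_bigr => k _; rewrite !mxE.
have : M a = M dual_coef.
  rewrite -[RHS]mulmx1 -(inv _ aE) mulmxA (mulmx1C (inv _ hecke_basis_dual)).
  by rewrite mul1mx.
move/matrixP/(_ (enum_rank w) (enum_rank v)).
by rewrite !mxE !enum_rankK.
Qed.

End YangBaxter.

Theorem theorem1 (r : nat) (D : rootDatum r)
  (H : algType (coefQ r)) (h : 'I_r -> H) (hH : is_hecke_algebra D h)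
  (Y : weyl D -> H) (hY : is_yang_baxter_basis h Y)
  (p pt : weyl D -> weyl D -> coefQ r)
  (hp : is_transition Y (hecke_basis h) p)
  (hpt : is_transition (hecke_basis h) Y pt) :
  forall w v : weyl D,
    pt w v = (-1) ^ ((weyl_length v)%:Z - (weyl_length w)%:Z)
             * p (v * longest D)%g (w * longest D)%g.
Proof.
move=> w v.
rewrite (transition_unique hH hY hp w v (fun v => transition_sum v hpt)).
by rewrite /dual_coef signr_subz.
Qed.
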